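(* Let $(\mathfrak g,[\cdot,\cdot])$ be an action-synchronized $\lim_{n\to\infty}(\phi_{1/n},\psi_{1/n})$-Lie algebra for a continuous action $\gamma:\mathfrak g\to\mathrm{Der}(\mathfrak g)$. Let $B:\mathfrak g\to\mathfrak g$ be a relative Rota-Baxter operator with limit-weight $\lim_{n\to\infty}(\phi_{1/n},\psi_{1/n})$ on $\mathfrak g$ for $\gamma$. Define $$u\vartriangleright v:=\lim_{n\to\infty}\psi_{1/n}\big(\gamma_{B(u)}(\phi_{1/n}(v))\big),\qquad u,v\in\mathfrak g.$$ Then $(\mathfrak g,[\cdot,\cdot],\vartriangleright)$ is a post-Lie algebra with limit-weight $\lim_{n\to\infty}(\phi_{1/n},\psi_{1/n})$. If in addition $\mathfrak g$ is $\lim_{n\to\infty}(\phi_{1/n},\psi_{1/n})$-abelian, then $\mathfrak g$ with $\vartriangleright$ is a pre-Lie algebra.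
   Context: The base field has characteristic zero. Synchronized limits: let $T$ be a topological space and $f_n:T\times T\to T$ ($n\ge1$) maps such that $\lim_{n\to\infty}f_n(a,b)$ uniquely exists for each $(a,b)$. The limit function is synchronized if $\lim_n f_n(a,b)=\lim_n f_n(a_n,b_n)$ for all sequences $a_n\to a$, $b_n\to b$ in $T$. A $\lim_n(\phi_{1/n},\psi_{1/n})$-Lie algebra is a topological Lie algebra $\mathfrak g$ with linear maps $\phi_{1/n},\psi_{1/n}:\mathfrak g\to\mathfrak g$ ($n\ge1$) such that $\phi_{1/n}\psi_{1/n}=\mathrm{id}$ for each $n$, the limit $[u,v]_\infty:=\lim_n\psi_{1/n}([\phi_{1/n}(u),\phi_{1/n}(v)])$ uniquely exists for all $u,v$, and the resulting map $\mathfrak g\times\mathfrak g\to\mathfrak g$ is synchronized. It is $\lim_n(\phi_{1/n},\psi_{1/n})$-abelian if $[u,v]_\infty=0$ for all $u,v$. It is action-synchronized for a Lie algebra action $\gamma:\mathfrak g\to\mathrm{Der}(\mathfrak g)$, $u\mapsto\gamma_u$, if for all $u,v$ the limit $\lim_n\psi_{1/n}(\gamma_u(\phi_{1/n}(v)))$ uniquely exists and equals $\lim_n\psi_{1/n}(\gamma_u(\phi_{1/n}(v_n)))$ for every sequence $v_n\to v$. A relative Rota-Baxter operator with limit-weight $\lim_n(\phi_{1/n},\psi_{1/n})$ on $\mathfrak g$ for $\gamma$ is a linear map $B:\mathfrak g\to\mathfrak g$ with $$[B(u),B(v)]=B\Big(\lim_{n\to\infty}\psi_{1/n}\big(\gamma_{B(u)}(\phi_{1/n}(v))-\gamma_{B(v)}(\phi_{1/n}(u))+[\phi_{1/n}(u),\phi_{1/n}(v)]\big)\Big),\quad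 u,v\in\mathfrak g.$$ A post-Lie algebra with limit-weight $\lim_n(\phi_{1/n},\psi_{1/n})$ is a $\lim_n(\phi_{1/n},\psi_{1/n})$-Lie algebra with a bilinear multiplication $\vartriangleright$ satisfying, for all $u,v,w$, $$u\vartriangleright[v,w]_\infty=[u\vartriangleright v,w]_\infty+[v,u\vartriangleright w]_\infty,$$ $$\big([u,v]_\infty+u\vartriangleright v-v\vartriangleright u\big)\vartriangleright w=u\vartriangleright(v\vartriangleright w)-v\vartriangleright(u\vartriangleright w).$$ A (left) pre-Lie algebra is a vector space with a bilinear operation satisfying $u\vartriangleright(v\vartriangleright w)-(u\vartriangleright v)\vartriangleright w=v\vartriangleright(u\vartriangleright w)-(v\vartriangleright u)\vartriangleright w$. *)

(* Defs.v *)
From HB Require Import structures.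
From mathcomp Require Import all_boot all_algebra.
From mathcomp Require Import sesquilinear.
From mathcomp Require Import boolp classical_sets functions filter topology.

Set Implicit Arguments.
Unset Strict Implicit.
Unset Printing Implicit Defensive.

Import GRing.Theory.
Local Open Scope classical_set_scope.
Local Open Scope ring_scope.

HB.mixin Record Zmodule_isTopologicalGroup V & Topological V & GRing.Zmodule V := {
  sub_continuous : continuous (fun x : V * V => x.1 - x.2)
}.

#[short(type="topologicalGroupType")]
HB.structure Definition TopologicalGroup :=
  {V of Topological V & GRing.Zmodule V & Zmodule_isTopologicalGroup V}.

(* The topology is part of the data of the field, so that the base field can be
   any topological field (in particular any field with the discrete topology);
   the topological modules of the libraries need a base ring with an order. *)
HB.mixin Record Field_isTopological K & TopologicalGroup K & GRing.Field K := {
  field_mul_continuous : continuous (fun x : K * K => x.1 * x.2) ;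
  field_inv_continuous : forall x : K, x != 0 -> {for x, continuous (@GRing.inv K)}
}.

#[short(type="topologicalFieldType")]
HB.structure Definition TopologicalField :=
  {K of TopologicalGroup K & GRing.Field K & Field_isTopological K}.

HB.mixin Record Lmodule_isLie (K : fieldType) g & GRing.Lmodule K g := {
  lie : g -> g -> g ;
  lie_bilinear : bilinear_for *:%R *:%R lie ;
  lie_alternating : forall u, lie u u = 0 ;
  lie_jacobi : forall u v w,
    lie u (lie v w) + lie v (lie w u) + lie w (lie u v) = 0
}.

#[short(type="lieAlgType")]
HB.structure Definition LieAlgebra (K : fieldType) :=
  {g of GRing.Lmodule K g & Lmodule_isLie K g}.

HB.mixin Record LieAlgebra_isTopological (K : topologicalFieldType) g
    & TopologicalGroup g & LieAlgebra K g := {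
  lie_scale_continuous : continuous (fun z : K * g => z.1 *: z.2) ;
  lie_bracket_continuous : continuous (fun z : g * g => lie z.1 z.2)
}.

(* The point is only the default value of [lim]. *)
#[short(type="topologicalLieAlgType")]
HB.structure Definition TopologicalLieAlgebra (K : topologicalFieldType) :=
  {g of Pointed g & TopologicalGroup g & LieAlgebra K g
      & LieAlgebra_isTopological K g}.

Definition lim_uniquely_exists {T : topologicalType} (x : nat -> T) : Prop :=
  exists! l : T, x @ \oo --> l.

Definition synchronized {T : ptopologicalType} (f : nat -> T -> T -> T) : Prop :=
  forall (a b : T) (a_ b_ : nat -> T),
    a_ @ \oo --> a -> b_ @ \oo --> b ->
    lim_uniquely_exists (fun n => f n (a_ n) (b_ n)) /\
    lim (f n a b @[n --> \oo]) = lim (f n (a_ n) (b_ n) @[n --> \oo]).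

Definition is_derivation (K : fieldType) (g : lieAlgType K) (D : g -> g) : Prop :=
  linear D /\ forall v w, D (lie v w) = lie (D v) w + lie v (D w).

(* A morphism of Lie algebras from [g] to [Der g]. *)
Record is_lie_action (K : fieldType) (g : lieAlgType K) (gamma : g -> g -> g)
    : Prop := {
  action_derivation : forall u, is_derivation (gamma u) ;
  action_linear : forall (a : K) u v w,
    gamma (a *: u + v) w = a *: gamma u w + gamma v w ;
  action_lie : forall u v w,
    gamma (lie u v) w = gamma u (gamma v w) - gamma v (gamma u w)
}.

Definition is_continuous_action (K : topologicalFieldType)
    (g : topologicalLieAlgType K) (gamma : g -> g -> g) : Prop :=
  is_lie_action gamma /\ continuous (fun z : g * g => gamma z.1 z.2).

(* In what follows [phi n] and [psi n] stand for the maps of index 1/n; their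
   values at n = 0 are irrelevant. *)

Definition lie_seq (K : topologicalFieldType) (g : topologicalLieAlgType K)
    (phi psi : nat -> {linear g -> g}) (n : nat) (u v : g) : g :=
  psi n (lie (phi n u) (phi n v)).

Definition lie_oo (K : topologicalFieldType) (g : topologicalLieAlgType K)
    (phi psi : nat -> {linear g -> g}) (u v : g) : g :=
  lim (lie_seq phi psi n u v @[n --> \oo]).

Record is_lim_lie (K : topologicalFieldType) (g : topologicalLieAlgType K)
    (phi psi : nat -> {linear g -> g}) : Prop := {
  lim_lie_cancel : forall n, (0 < n)%N -> phi n \o psi n =1 id ;
  lim_lie_lim : forall u v, lim_uniquely_exists (fun n => lie_seq phi psi n u v) ;
  lim_lie_synchronized : synchronized (lie_seq phi psi)
}.

Definition is_lim_abelian (K : topologicalFieldType)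
    (g : topologicalLieAlgType K) (phi psi : nat -> {linear g -> g}) : Prop :=
  forall u v, lie_oo phi psi u v = 0.

Definition action_synchronized (K : topologicalFieldType)
    (g : topologicalLieAlgType K) (phi psi : nat -> {linear g -> g})
    (gamma : g -> g -> g) : Prop :=
  forall u v : g,
    lim_uniquely_exists (fun n => psi n (gamma u (phi n v))) /\
    forall v_ : nat -> g, v_ @ \oo --> v ->
      lim_uniquely_exists (fun n => psi n (gamma u (phi n (v_ n)))) /\
      lim (psi n (gamma u (phi n v)) @[n --> \oo]) =
      lim (psi n (gamma u (phi n (v_ n))) @[n --> \oo]).

Definition is_relative_rota_baxter (K : topologicalFieldType)
    (g : topologicalLieAlgType K) (phi psi : nat -> {linear g -> g})
    (gamma : g -> g -> g) (B : {linear g -> g}) : Prop :=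
  forall u v : g,
    lie (B u) (B v) =
    B (lim (psi n (gamma (B u) (phi n v) - gamma (B v) (phi n u)
                   + lie (phi n u) (phi n v)) @[n --> \oo])).

Record is_lim_post_lie (K : topologicalFieldType) (g : topologicalLieAlgType K)
    (phi psi : nat -> {linear g -> g}) (tri : g -> g -> g) : Prop := {
  post_lie_lim_lie : is_lim_lie phi psi ;
  post_lie_bilinear : bilinear_for *:%R *:%R tri ;
  post_lie_derivation : forall u v w,
    tri u (lie_oo phi psi v w) =
    lie_oo phi psi (tri u v) w + lie_oo phi psi v (tri u w) ;
  post_lie_assoc : forall u v w,
    tri (lie_oo phi psi u v + tri u v - tri v u) w =
    tri u (tri v w) - tri v (tri u w)
}.

Record is_pre_lie (K : fieldType) (V : lmodType K) (tri : V -> V -> V)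
    : Prop := {
  pre_lie_bilinear : bilinear_for *:%R *:%R tri ;
  pre_lie_assoc : forall u v w,
    tri u (tri v w) - tri (tri u v) w = tri v (tri u w) - tri (tri v u) w
}.

Definition rb_product (K : topologicalFieldType) (g : topologicalLieAlgType K)
    (phi psi : nat -> {linear g -> g}) (gamma : g -> g -> g)
    (B : {linear g -> g}) (u v : g) : g :=
  lim (psi n (gamma (B u) (phi n v)) @[n --> \oo]).

(* Main.v *)
(* Synchronization allows the constant sequences in the limits defining [_, _]_oo
   and |> to be replaced by convergent ones.  Since phi_(1/n) psi_(1/n) = id, the
   inner limits of u |> [v, w]_oo and u |> (v |> w) then telescope into a single
   psi_(1/n), under which the two axioms are the derivation property of gamma_(B u)
   and gamma_[B u, B v] = [gamma_(B u), gamma_(B v)], with [B u, B v] rewritten by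
   the Rota-Baxter identity. *)
Require Import Defs.
From mathcomp Require Import all_boot all_algebra.
From mathcomp Require Import sesquilinear.
From mathcomp Require Import boolp classical_sets functions filter topology.

Import GRing.Theory.

Local Open Scope classical_set_scope.
Local Open Scope ring_scope.

Lemma cvg_seq_cst {T : topologicalType} (a : T) :
  (fun _ : nat => a) @ \oo --> a.
Proof. exact: cvg_cst. Qed.

Section TopologicalGroupLimits.
Context {V : topologicalGroupType}.
Implicit Types (x y : nat -> V) (a b l : V).

Lemma cvg_seqB {x y a b} : x @ \oo --> a -> y @ \oo --> b ->
  x n - y n @[n --> \oo] --> a - b.
Proof.
move=> xa yb; apply: (continuous2_cvg _ (h := fun p q : V => p - q)) xa yb.
exact: (@sub_continuous V (a, b)).
Qed.

(** Only subtraction comes with a continuity axiom, so the sum is obtained as x - (0 - y). *)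
Lemma cvg_seqD {x y a b} : x @ \oo --> a -> y @ \oo --> b ->
  x n + y n @[n --> \oo] --> a + b.
Proof.
move=> xa yb; have yNb := cvg_seqB (cvg_seq_cst 0) yb.
have := cvg_seqB xa yNb; rewrite sub0r opprK.
by under eq_fun do rewrite sub0r opprK.
Qed.

(* No separation axiom is assumed: if [x] has only one limit and [y] tends to
   both [a] and [b], then [x + (y - y)] also tends to [l + (a - b)]. *)
Lemma cvg_seq_unique {x} : lim_uniquely_exists x ->
  forall y a b, y @ \oo --> a -> y @ \oo --> b -> a = b.
Proof.
move=> [l [xl l_uniq]] y a b ya yb.
have := cvg_seqD xl (cvg_seqB ya yb).
under eq_fun do rewrite subrr addr0.
by move/l_uniq/esym/eqP; rewrite -subr_eq0 addrC addKr subr_eq0 => /eqP.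
Qed.

End TopologicalGroupLimits.

Lemma lim_uniquely_exists_cvg {T : ptopologicalType} {x : nat -> T} :
  lim_uniquely_exists x -> x @ \oo --> lim (x @ \oo).
Proof. by move=> [l [xl _]]; exact: cvgP xl. Qed.

(** The relation between [phi n] and [psi n] is available only for n > 0; discarding the index 0
    allows it to be used under a limit. *)
Lemma eq_pos_cvg {T : topologicalType} {x y : nat -> T} {l : T} :
  (forall n, (0 < n)%N -> x n = y n) -> x @ \oo --> l -> y @ \oo --> l.
Proof.
move=> xy; apply: cvg_trans; apply: near_eq_cvg.
by exists 1%N => // n /= n_gt0; rewrite xy.
Qed.

Section RotaBaxter.
Context {K : topologicalFieldType} {g : topologicalLieAlgType K}.
Context {phi psi : nat -> {linear g -> g}} {gamma : g -> g -> g}.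
Context {B : {linear g -> g}}.
Hypothesis hlim : is_lim_lie phi psi.
Hypothesis hgamma : is_lie_action gamma.
Hypothesis hsync : action_synchronized phi psi gamma.
Hypothesis hB : is_relative_rota_baxter phi psi gamma B.
Implicit Types u v w : g.

Let tri := rb_product phi psi gamma B.
Let lim_lie := lie_oo phi psi.

(** One sequence with a unique limit forces uniqueness for all sequences in the group; the bracket
    sequence at (0, 0) is such a sequence. *)
Let cvg_unique {x : nat -> g} {a b : g} : x @ \oo --> a -> x @ \oo --> b -> a = b.
Proof. exact: cvg_seq_unique (lim_lie_lim hlim 0 0) x a b. Qed.

Let phiK {n} : (0 < n)%N -> cancel (psi n) (phi n).
Proof. by move=> n0 v; exact: lim_lie_cancel hlim n n0 v. Qed.

Lemma cvg_seqZ (c : K) {x : nat -> g} {a : g} : x @ \oo --> a ->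
  c *: x n @[n --> \oo] --> c *: a.
Proof.
move=> xa.
apply: (continuous2_cvg _ (h := fun (k : K) (v : g) => k *: v)) (cvg_cst c) xa.
exact: (@lie_scale_continuous K g (c, a)).
Qed.

Lemma lie_seq_cvg {u_ v_ : nat -> g} {u v} :
  u_ @ \oo --> u -> v_ @ \oo --> v ->
  lie_seq phi psi n (u_ n) (v_ n) @[n --> \oo] --> lim_lie u v.
Proof.
move=> uu vv; have [ex limE] := lim_lie_synchronized hlim uu vv.
by rewrite /lim_lie /lie_oo limE; exact: lim_uniquely_exists_cvg ex.
Qed.

(** Here [B u] stays fixed. This suffices: nested limits occur in the right operand, and a limit in
    the left operand is seen only through [B], where the Rota-Baxter identity evaluates it. *)
Lemma rb_product_cvg u {v_ : nat -> g} {v} : v_ @ \oo --> v ->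
  psi n (gamma (B u) (phi n (v_ n))) @[n --> \oo] --> tri u v.
Proof.
move=> vv; have [ex limE] := (hsync (B u) v).2 v_ vv.
by rewrite /tri /rb_product limE; exact: lim_uniquely_exists_cvg ex.
Qed.

Let rb_product_cvg_cst u v :
  psi n (gamma (B u) (phi n v)) @[n --> \oo] --> tri u v.
Proof. exact: (rb_product_cvg u (cvg_seq_cst v)). Qed.

Let gamma_linear u : linear (gamma u).
Proof. by case: (action_derivation hgamma u). Qed.

(** The terms are bilinear for each n, and uniqueness of limits carries this over to [tri]. *)
Lemma rb_product_bilinear : bilinear_for *:%R *:%R tri.
Proof.
split=> [v c u u'|u c v v']; apply: cvg_unique (rb_product_cvg_cst _ _) _.
- have := cvg_seqD (cvg_seqZ c (rb_product_cvg_cst u v)) (rb_product_cvg_cst u' v).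
  by under eq_fun do rewrite -linearP -(action_linear hgamma) -linearP.
- have := cvg_seqD (cvg_seqZ c (rb_product_cvg_cst u v)) (rb_product_cvg_cst u v').
  by under eq_fun do rewrite -linearP -gamma_linear -linearP.
Qed.

Lemma rb_product_derivation u v w :
  tri u (lim_lie v w) = lim_lie (tri u v) w + lim_lie v (tri u w).
Proof.
have vw := lie_seq_cvg (cvg_seq_cst v) (cvg_seq_cst w).
apply: cvg_unique (rb_product_cvg u vw) _.
have := cvg_seqD (lie_seq_cvg (rb_product_cvg_cst u v) (cvg_seq_cst w))
                 (lie_seq_cvg (cvg_seq_cst v) (rb_product_cvg_cst u w)).
apply: eq_pos_cvg => n n_gt0.
(* Once [phi n] cancels [psi n], both sequences are [psi n] of the Leibniz rule at [phi n v] and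
   [phi n w]. *)
rewrite /lie_seq !(phiK n_gt0) -linearD.
by rewrite -(action_derivation hgamma (B u)).2.
Qed.

(** The limit inside the Rota-Baxter identity splits into three limits that exist separately. Thus
    [B] carries the sub-adjacent bracket of the post-Lie structure to [lie]. *)
Lemma rota_baxter_rb_product u v :
  B (lim_lie u v + tri u v - tri v u) = lie (B u) (B v).
Proof.
rewrite hB; congr (B _).
have cvg_rhs : psi n (gamma (B u) (phi n v) - gamma (B v) (phi n u)
    + lie (phi n u) (phi n v)) @[n --> \oo] --> lim_lie u v + tri u v - tri v u.
  have := cvg_seqD (cvg_seqB (rb_product_cvg_cst u v) (rb_product_cvg_cst v u))
                   (lie_seq_cvg (cvg_seq_cst u) (cvg_seq_cst v)).
  have -> : lim_lie u v + tri u v - tri v u = tri u v - tri v u + lim_lie u v.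
    by rewrite -addrA addrC.
  by under eq_fun do rewrite /lie_seq -linearB -linearD.
(* Having some limit, the sequence also converges to its chosen value [lim]; uniqueness identifies
   the two. *)
exact: cvg_unique cvg_rhs (cvgP _ cvg_rhs).
Qed.

Lemma rb_product_assoc u v w :
  tri (lim_lie u v + tri u v - tri v u) w = tri u (tri v w) - tri v (tri u w).
Proof.
apply: cvg_unique (rb_product_cvg_cst _ _) _.
rewrite rota_baxter_rb_product.
have := cvg_seqB (rb_product_cvg u (rb_product_cvg_cst v w))
                 (rb_product_cvg v (rb_product_cvg_cst u w)).
apply: eq_pos_cvg => n n_gt0.
by rewrite !(phiK n_gt0) -linearB (action_lie hgamma).
Qed.

Lemma rb_product_post_lie : is_lim_post_lie phi psi tri.
Proof.
split; [exact: hlim | exact: rb_product_bilinear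
       | exact: rb_product_derivation | exact: rb_product_assoc].
Qed.

End RotaBaxter.

(** With a zero limit bracket, the second post-Lie axiom becomes the pre-Lie identity after
    expanding its left operand and regrouping. *)
Lemma post_lie_abelian_pre_lie (K : topologicalFieldType)
    (g : topologicalLieAlgType K) (phi psi : nat -> {linear g -> g})
    (tri : g -> g -> g) :
  is_lim_post_lie phi psi tri -> is_lim_abelian phi psi -> is_pre_lie tri.
Proof.
move=> [_ tri_bilinear _ tri_assoc] abelian; split=> // u v w.
have triBl x y : tri (x - y) w = tri x w - tri y w.
  (* The scalar -1 applied to y yields the difference x - y. *)
  by have := tri_bilinear.1 w (-1) y x; rewrite /= !scaleN1r ![- _ + _]addrC.
have := tri_assoc u v w; rewrite abelian add0r triBl => /esym/eqP.
by rewrite subr_eq => /eqP ->; rewrite addrC -addrA addKr addrC.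
Qed.

Theorem proposition3p9 (K : topologicalFieldType) (charK0 : [pchar K] =i pred0)
    (g : topologicalLieAlgType K) (phi psi : nat -> {linear g -> g})
    (gamma : g -> g -> g) (B : {linear g -> g})
    (hlim : is_lim_lie phi psi)
    (hgamma : is_continuous_action gamma)
    (hsync : action_synchronized phi psi gamma)
    (hB : is_relative_rota_baxter phi psi gamma B) :
  is_lim_post_lie phi psi (rb_product phi psi gamma B) /\
  (is_lim_abelian phi psi -> is_pre_lie (rb_product phi psi gamma B)).
Proof.
have post_lie := rb_product_post_lie hlim hgamma.1 hsync hB.
by split=> //; exact: post_lie_abelian_pre_lie.
Qed.
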